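(* Let $d\ge1$, let $\mathbb{F}$ be the flip operator on $\mathbb{C}^d\otimes\mathbb{C}^d$, $\mathbb{F}|k,l\rangle=|l,k\rangle$, let $|\Omega\rangle=d^{-1/2}\sum_{j=1}^d|j,j\rangle$, and let $\mathcal{U}=\mathrm{conv}\{(\mathbb{1}\otimes U)|\Omega\rangle\langle\Omega|(\mathbb{1}\otimes U^\dagger): U\in\mathcal{M}_d\text{ unitary}\}$. Let $B\in\mathcal{M}_d$ have singular values $\sigma_1\ge\dots\ge\sigma_d$, let $w\in\mathbb{R}$ and $W=(\mathbb{1}\otimes B)\mathbb{F}(\mathbb{1}\otimes B^\dagger)+w\,\mathbb{1}$. Then $\operatorname{tr}[W\sigma]\ge0$ for all $\sigma\in\mathcal{U}$ if and only if $$w\ge\frac1d\begin{cases}2\sum_{i=1}^{d/2}\sigma_{2i-1}\sigma_{2i}, & d\text{ even},\\ 2\Big(\sum_{i=1}^{(d-1)/2}\sigma_{2i-1}\sigma_{2i}\Big)-\sigma_d^2, & d\text{ odd}.\end{cases}$$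
   Context: A Hermitian operator $W$ with $\operatorname{tr}[W\sigma]\ge 0$ for all $\sigma\in\mathcal{U}$ is called a separation witness; $\mathcal{U}$ is the set of Jamiolkowski (Choi) states of convex combinations of unitary channels. *)

(* Defs.v *)
From HB Require Import structures.
From mathcomp Require Import all_boot all_order all_algebra.
From mathcomp Require Import mxtens.
Set Implicit Arguments. Unset Strict Implicit. Unset Printing Implicit Defensive.
Import Order.TTheory GRing.Theory Num.Theory Num.Def.
Local Open Scope ring_scope.

Section Defs.
Variable C : numClosedFieldType.

Definition adjmx {m n} (A : 'M[C]_(m, n)) : 'M[C]_(n, m) := (map_mx conjC A)^T.

Definition unitary {n} (U : 'M[C]_n) : Prop := U *m adjmx U = 1%:M.

(* flip operator on C^d (x) C^d : F |k,l> = |l,k> ;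
   the basis vector |k,l> has index mxtens_index (k,l), consistent with tensmx *)
Definition flip (d : nat) : 'M[C]_(d * d) :=
  \matrix_(a, b) ((((mxtens_unindex a).1 == (mxtens_unindex b).2) &&
                   ((mxtens_unindex a).2 == (mxtens_unindex b).1))%:R).

Definition omega (d : nat) : 'cV[C]_(d * d) :=
  (sqrtC (d%:R))^-1 *: \sum_(j < d) ((delta_mx j 0 : 'cV[C]_d) *t (delta_mx j 0 : 'cV[C]_d)).

Definition choi_unitary (d : nat) (U : 'M[C]_d) : 'M[C]_(d * d) :=
  ((1%:M : 'M[C]_d) *t U) *m (omega d *m adjmx (omega d)) *m ((1%:M : 'M[C]_d) *t adjmx U).

Definition in_U (d : nat) (s : 'M[C]_(d * d)) : Prop :=
  exists (k : nat) (p : 'I_k -> C) (U : 'I_k -> 'M[C]_d),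
    (forall i, 0 <= p i) /\ \sum_(i < k) p i = 1 /\ (forall i, unitary (U i)) /\
    s = \sum_(i < k) p i *: choi_unitary (U i).

Definition singular_values (d : nat) (B : 'M[C]_d) (sv : 'I_d -> C) : Prop :=
  (forall i, 0 <= sv i) /\ (forall i j : 'I_d, (i <= j)%N -> sv j <= sv i) /\
  exists U V : 'M[C]_d, unitary U /\ unitary V /\
    B = U *m diag_mx (\row_i sv i) *m V.

(* sigma_{k+1} in 0-based indexing, 0 outside range (never used outside) *)
Definition sv_nat (d : nat) (sv : 'I_d -> C) (k : nat) : C :=
  if insub k is Some i then sv i else 0.

Definition threshold (d : nat) (sv : 'I_d -> C) : C :=
  (d%:R)^-1 * (2 * \sum_(i < d./2) sv_nat sv i.*2 * sv_nat sv i.*2.+1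
               - (if odd d then sv_nat sv d.-1 ^+ 2 else 0)).

End Defs.

(* Main.v *)
(* For [B = P S Q] with [S = diag sv], the expectation of the flip part of [W]
   in the Choi state of [U] is [d^-1 * sum_(j, k) sv_j sv_k Y_jk conj(Y_kj)],
   where [Y = conj(Q) U^* P] runs through all unitaries.  This form is real, so
   twice it is the sum of the [sv_j sv_k flip_form Y j k].  Its minimum over [Y]
   is attained at the signed permutation [pairing_mx] which pairs the indices
   [2i] and [2i+1].  Indeed, Abel summation writes the form as a combination,
   with nonnegative coefficients, of the sums of [flip_form Y] over the corner
   blocks [j < a, k < b], and [pairing_mx] minimizes each of these separately:
   for [a <> b] or [a = b] even the bound is the arithmetic-geometric mean
   inequality, and for [a = b] odd the parallelogram law reduces it to a bound
   on the norm of the antisymmetric part of a contraction of odd size, which is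
   singular. *)
Require Import Defs.
From HB Require Import structures.
From mathcomp Require Import all_boot all_order all_algebra.
From mathcomp Require Import mxtens ring zify.
Import Order.TTheory GRing.Theory Num.Theory.
Local Open Scope ring_scope.

Section FlipWitness.

Set Implicit Arguments. Unset Strict Implicit. Unset Printing Implicit Defensive.
Variable C : numClosedFieldType.

(** * Adjoints and unitary matrices *)

Lemma adjmxE m n (A : 'M[C]_(m, n)) i j : adjmx A i j = (A j i)^*.
Proof. by rewrite !mxE. Qed.

Lemma adjmxM m n p (A : 'M[C]_(m, n)) (B : 'M[C]_(n, p)) :
  adjmx (A *m B) = adjmx B *m adjmx A.
Proof. by rewrite /adjmx map_mxM trmx_mul. Qed.

Lemma adjmxK m n (A : 'M[C]_(m, n)) : adjmx (adjmx A) = A.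
Proof. by apply/matrixP=> i j; rewrite !adjmxE conjCK. Qed.

Lemma unitary_adj n (U : 'M[C]_n) : unitary U -> unitary (adjmx U).
Proof. by rewrite /unitary adjmxK => /mulmx1C. Qed.

Lemma unitary_mul n (U V : 'M[C]_n) :
  unitary U -> unitary V -> unitary (U *m V).
Proof.
by move=> hU hV; rewrite /unitary adjmxM mulmxA -(mulmxA U) hV mulmx1.
Qed.

Lemma unitary_tr n (U : 'M[C]_n) : unitary U -> unitary U^T.
Proof.
move=> /mulmx1C hU; apply: (can_inj (@trmxK _ _ _)).
by rewrite trmx_mul trmxK trmx1 -[RHS]hU /adjmx map_trmx trmxK.
Qed.

(** * The squared Frobenius norm, contractions and antisymmetric matrices *)

Definition sqnorm m n (A : 'M[C]_(m, n)) : C := \sum_i \sum_j `|A i j| ^+ 2.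

Lemma sqnorm_ge0 m n (A : 'M[C]_(m, n)) : 0 <= sqnorm A.
Proof. by do 2!apply: sumr_ge0 => ? _; rewrite exprn_ge0. Qed.

Lemma sqnorm_trace m n (A : 'M[C]_(m, n)) : sqnorm A = \tr (adjmx A *m A).
Proof.
rewrite /sqnorm exchange_big; apply: eq_bigr => j _; rewrite mxE.
by apply: eq_bigr => i _; rewrite adjmxE normCK mulrC.
Qed.

Lemma sqnorm_tr m n (A : 'M[C]_(m, n)) : sqnorm A^T = sqnorm A.
Proof.
by rewrite /sqnorm exchange_big; do 2!apply: eq_bigr => ? _; rewrite mxE.
Qed.

Lemma sqnorm_isom m n p (E : 'M[C]_(m, n)) (A : 'M[C]_(n, p)) :
  adjmx E *m E = 1%:M -> sqnorm (E *m A) = sqnorm A.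
Proof. by move=> hE; rewrite !sqnorm_trace adjmxM mulmxA -(mulmxA _ _ E) hE mulmx1. Qed.

Lemma sqnorm_parallelogram m n (A B : 'M[C]_(m, n)) :
  sqnorm (A + B) + sqnorm (A - B) = 2 * (sqnorm A + sqnorm B).
Proof.
rewrite /sqnorm -!big_split mulr_sumr; apply: eq_bigr => i _ /=.
rewrite -!big_split mulr_sumr; apply: eq_bigr => j _ /=.
by rewrite !mxE !normCK !rmorphD !rmorphN; ring.
Qed.

Lemma sqnorm_rowsub m n p (f : 'I_p -> 'I_m) (A : 'M[C]_(m, n)) :
  injective f -> sqnorm (rowsub f A) <= sqnorm A.
Proof.
move=> f_inj; rewrite /sqnorm.
under eq_bigr do under eq_bigr do rewrite mxE.
rewrite -(big_imset (fun i => \sum_j `|A i j| ^+ 2)) /=; last by move=> ? ? _ _ /f_inj.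
rewrite [leRHS](bigID [in [set f x | x in 'I_p]]) /= lerDl.
by do 2!apply: sumr_ge0 => ? _; rewrite exprn_ge0.
Qed.

(** With [E] the coordinate embedding given by [f], the block is [E^* U E]: both [E] and [U]
    preserve the norm, and [E^*] only drops rows. *)
Lemma sqnorm_mxsub_unitary_mul m n p (f : 'I_m -> 'I_n) (U : 'M[C]_n)
    (A : 'M[C]_(m, p)) :
  injective f -> unitary U -> sqnorm (mxsub f f U *m A) <= sqnorm A.
Proof.
move=> f_inj /mulmx1C hU.
have -> : mxsub f f U = rowsub f (U *m colsub f 1%:M).
  by rewrite mulmx_colsub mulmx1; apply/matrixP=> i j; rewrite !mxE.
rewrite mul_rowsub_mx; apply: le_trans (sqnorm_rowsub _ f_inj) _.
rewrite -mulmxA sqnorm_isom // sqnorm_isom //.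
apply/matrixP=> i j; rewrite !mxE (bigD1 (f i)) //= !mxE eqxx rmorph1 mul1r.
rewrite big1 ?addr0 => [|k /negPf nk]; first by rewrite (inj_eq f_inj).
by rewrite !mxE nk rmorph0 mul0r.
Qed.

(* An antisymmetric matrix of odd size kills a nonzero vector [v], so [D] is
   unchanged by the projection onto the complement of [v], whose squared norm
   is [m - 1]. *)
Lemma sqnorm_antisym_odd m (D : 'M[C]_m) (c : C) :
  odd m -> D^T = - D ->
  (forall A : 'M[C]_m, sqnorm (D *m A) <= c * sqnorm A) ->
  sqnorm D <= c * (m.-1)%:R.
Proof.
move=> m_odd DT hD.
(* Transposition gives [det D = (-1)^m det D = - det D]. *)
have /det0P[v v0 vD] : \det D == 0.
  have := det_tr D; rewrite DT -scaleN1r detZ -signr_odd m_odd mulN1r.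
  by move/eqP; rewrite eq_sym -addr_eq0 -mulr2n mulrn_eq0.
have Dv : D *m v^T = 0.
  by apply: (can_inj (@trmxK _ _ _)); rewrite trmx_mul trmxK DT mulmxN vD oppr0 trmx0.
have nv0 : sqnorm v != 0.
  apply: contraNneq v0 => /psumr_eq0P h; apply/eqP/matrixP=> i j.
  have /psumr_eq0P h2 : \sum_j `|v i j| ^+ 2 = 0.
    by apply: h => // k _; apply: sumr_ge0 => ? _; rewrite exprn_ge0.
  have /eqP := h2 (fun k _ => exprn_ge0 2 (normr_ge0 _)) j isT.
  by rewrite expf_eq0 normr_eq0 mxE => /eqP.
pose P := 1%:M - (sqnorm v)^-1 *: (v^T *m adjmx v^T).
have DP : D *m P = D.
  by rewrite mulmxBr mulmx1 -scalemxAr mulmxA Dv mul0mx scaler0 subr0.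
have vv : adjmx v^T *m v^T = (sqnorm v)%:M.
  by rewrite [LHS]mx11_scalar -trace_mx11 -sqnorm_trace sqnorm_tr.
have Padj : adjmx P = P.
  apply/matrixP=> i j; rewrite adjmxE !mxE !big_ord_recl !big_ord0 !addr0 !mxE.
  rewrite rmorphB rmorph_nat eq_sym !rmorphM fmorphV /= conjCK.
  by rewrite (CrealP (ger0_real (sqnorm_ge0 v))) [X in _ * X]mulrC.
have PP : P *m P = P.
  rewrite {2}/P mulmxBr mulmx1 -scalemxAr mulmxA mulmxBl mul1mx -scalemxAl.
  rewrite -mulmxA vv mul_mx_scalar scalerA mulVf // scale1r subrr mul0mx.
  by rewrite scaler0 subr0.
have nP : sqnorm P = (m.-1)%:R.
  rewrite sqnorm_trace Padj PP /P raddfB /= mxtrace1 mxtraceZ mxtrace_mulC.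
  rewrite vv mxtrace_scalar mulr1n mulVf //.
  by rewrite -subn1 natrB //; case: m m_odd {D DT hD v v0 vD Dv nv0 P DP vv Padj PP}.
by rewrite -nP -{1}DP.
Qed.

(** * Lower bounds on the corner blocks of the flip form *)

(** Twice the real part of [Y_jk conj(Y_kj)]; symmetrizing makes each term real, hence comparable in
    the partial order of [C]. *)
Definition flip_form n (Y : 'M[C]_n) (j k : 'I_n) : C :=
  Y j k * (Y k j)^* + Y k j * (Y j k)^*.

Lemma flip_formC n (Y : 'M[C]_n) j k : flip_form Y j k = flip_form Y k j.
Proof. exact: addrC. Qed.

Lemma flip_form_ge n (Y : 'M[C]_n) j k :
  - (`|Y j k| ^+ 2 + `|Y k j| ^+ 2) <= flip_form Y j k.
Proof.
rewrite -subr_ge0; have := exprn_ge0 2 (normr_ge0 (Y j k + Y k j)).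
by congr (0 <= _); rewrite /flip_form !normCK rmorphD; ring.
Qed.

(** Expanding [|Y_jk - Y_kj|^2] shows that, at fixed norm, a small form means a large antisymmetric
    part. *)
Lemma sum_flip_form n (Y : 'M[C]_n) :
  \sum_j \sum_k flip_form Y j k = 2 * sqnorm Y - sqnorm (Y - Y^T).
Proof.
have -> : 2 * sqnorm Y = sqnorm Y + sqnorm Y^T by rewrite sqnorm_tr; ring.
rewrite /sqnorm -big_split -sumrB.
apply: eq_bigr => j _; rewrite -big_split -sumrB; apply: eq_bigr => k _ /=.
by rewrite !mxE !normCK rmorphB /flip_form; ring.
Qed.

(** The block and its transpose are contractions, so by the parallelogram law their difference at
    most doubles norms; this is [sqnorm_antisym_odd] with [c = 4]. *)
Lemma sqnorm_antisym_mxsub m n (f : 'I_m -> 'I_n) (U : 'M[C]_n) :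
  injective f -> unitary U -> odd m ->
  sqnorm (mxsub f f U - (mxsub f f U)^T) <= 4 * (m.-1)%:R.
Proof.
move=> f_inj hU m_odd; apply: sqnorm_antisym_odd => // [|A].
  by rewrite linearB /= trmxK opprB.
rewrite mulmxBl; set A1 := _ *m A; set A2 := _ *m A.
have h1 : sqnorm A1 <= sqnorm A by apply: sqnorm_mxsub_unitary_mul.
have h2 : sqnorm A2 <= sqnorm A.
  by rewrite /A2 trmx_mxsub; apply: sqnorm_mxsub_unitary_mul => //; apply: unitary_tr.
have : sqnorm (A1 - A2) <= sqnorm (A1 + A2) + sqnorm (A1 - A2).
  by rewrite lerDr sqnorm_ge0.
rewrite sqnorm_parallelogram => /le_trans; apply.
have -> : 4 * sqnorm A = 2 * (sqnorm A + sqnorm A) by ring.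
by rewrite ler_pM2l ?ltr0n // lerD.
Qed.

Lemma sqnorm_unitary n (U : 'M[C]_n) : unitary U -> sqnorm U = n%:R.
Proof. by move=> /mulmx1C hU; rewrite sqnorm_trace hU mxtrace1. Qed.

Lemma unitary_row_norm n (U : 'M[C]_n) i :
  unitary U -> \sum_j `|U i j| ^+ 2 = 1.
Proof.
move=> /matrixP/(_ i i); rewrite !mxE eqxx mulr1n => <-.
by apply: eq_bigr => j _; rewrite adjmxE normCK.
Qed.

Lemma unitary_col_norm n (U : 'M[C]_n) j :
  unitary U -> \sum_i `|U i j| ^+ 2 = 1.
Proof.
move=> /unitary_tr/(unitary_row_norm j) <-.
by apply: eq_bigr => i _; rewrite mxE.
Qed.

(** After [flip_form_ge], each of the [a] rows costs at most the norm of one row plus that of one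
    column of [U], which is [2]. *)
Lemma flip_block_ge n (U : 'M[C]_n) a b :
  unitary U -> (a <= n)%N ->
  - (2 * a%:R) <=
    \sum_(j < n | (j < a)%N) \sum_(k < n | (k < b)%N) flip_form U j k.
Proof.
move=> hU le_an.
have -> : - (2 * a%:R) = \sum_(j < n | (j < a)%N) (- 2) :> C.
  by rewrite (big_ord_narrow le_an) sumr_const card_ord mulr_natr mulNrn.
apply: ler_sum => j _.
apply: le_trans (_ : \sum_(k < n | (k < b)%N) - (`|U j k| ^+ 2 + `|U k j| ^+ 2) <= _); last first.
  by apply: ler_sum => k _; apply: flip_form_ge.
rewrite sumrN lerN2.
have <- : \sum_k (`|U j k| ^+ 2 + `|U k j| ^+ 2) = 2.
  rewrite big_split /= unitary_row_norm //.
  by rewrite unitary_col_norm.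
rewrite [leRHS](bigID (fun k : 'I_n => (k < b)%N)) /= lerDl.
by apply: sumr_ge0 => k _; rewrite addr_ge0 ?exprn_ge0.
Qed.

(** By the parallelogram law twice the sum is [|X + X^T|^2 - |X - X^T|^2] for the corner [X]; the
    last term is at most [4(a - 1)]. *)
Lemma flip_block_odd_ge n (U : 'M[C]_n) a :
  unitary U -> (a <= n)%N -> odd a ->
  - (2 * (a.-1)%:R) <=
    \sum_(j < n | (j < a)%N) \sum_(k < n | (k < a)%N) flip_form U j k.
Proof.
move=> hU le_an a_odd; pose f := widen_ord le_an.
have f_inj : injective f by move=> x y [] /ord_inj.
have := sqnorm_antisym_mxsub f_inj hU a_odd.
rewrite (big_ord_narrow le_an).
under eq_bigr do rewrite (big_ord_narrow le_an).
set X := mxsub f f U => hX.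
rewrite [leRHS](_ : _ = \sum_j \sum_k flip_form X j k); last first.
  by do 2!apply: eq_bigr => ? _; rewrite /flip_form !mxE.
rewrite sum_flip_form.
have hp := sqnorm_parallelogram X X^T; rewrite sqnorm_tr in hp.
have h0 := sqnorm_ge0 (X + X^T).
rewrite -(ler_pM2l (ltr0n C 2)) -subr_ge0.
have -> : 2 * (2 * sqnorm X - sqnorm (X - X^T)) - 2 * - (2 * a.-1%:R)
  = sqnorm (X + X^T) + (4 * a.-1%:R - sqnorm (X - X^T)).
  have -> : sqnorm (X + X^T) = 4 * sqnorm X - sqnorm (X - X^T).
    by apply/eqP; rewrite eq_sym subr_eq hp; apply/eqP; ring.
  by ring.
by rewrite addr_ge0 // subr_ge0.
Qed.

(** On the whole matrix the norm is exactly [n], which improves the corner bound [-2(n - 1)] by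
    [2]. *)
Lemma flip_full_odd_ge n (U : 'M[C]_n) :
  unitary U -> odd n ->
  2 * n%:R - 4 * (n.-1)%:R <= \sum_j \sum_k flip_form U j k.
Proof.
move=> hU n_odd; rewrite sum_flip_form sqnorm_unitary // lerD2l lerN2.
have := sqnorm_antisym_mxsub (@inj_id 'I_n) hU n_odd.
by rewrite mxsub_id.
Qed.

(** * Abel summation over corner blocks *)

Definition block n (h : 'I_n -> 'I_n -> C) (a b : nat) : C :=
  \sum_(j < n | (j < a)%N) \sum_(k < n | (k < b)%N) h j k.

Lemma sum_abel n (s : nat -> C) (h : 'I_n -> 'I_n -> C) :
  s n = 0 ->
  \sum_(j < n) \sum_(k < n) s j * s k * h j k =
  \sum_(a < n) \sum_(b < n)
    (s a - s a.+1) * (s b - s b.+1) * block h a.+1 b.+1.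
Proof.
move=> sn0.
(* The sum telescopes from [s j] down to [s n = 0]. *)
have sE (j : 'I_n) : s j = \sum_(a < n | (j < a.+1)%N) (s a - s a.+1).
  rewrite -(big_geq_mkord j n xpredT (fun a => s a - s a.+1)).
  under eq_bigr do rewrite -opprB.
  by rewrite sumrN telescope_sumr ?(ltnW (ltn_ord j)) // sn0 sub0r opprK.
transitivity (\sum_(j < n) \sum_(k < n) \sum_(a < n | (j < a.+1)%N) \sum_(b < n | (k < b.+1)%N)
    (s a - s a.+1) * (s b - s b.+1) * h j k).
  apply: eq_bigr => j _; apply: eq_bigr => k _.
  rewrite (sE j) (sE k) big_distrlr /= mulr_suml; apply: eq_bigr => a _.
  by rewrite mulr_suml.
under eq_bigr do rewrite exchange_big /=.
rewrite (exchange_big_dep xpredT) //=; apply: eq_bigr => a _.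
under eq_bigr do rewrite (exchange_big_dep xpredT) //=.
rewrite exchange_big /=; apply: eq_bigr => b _.
rewrite /block mulr_sumr; apply: eq_bigr => j _.
by rewrite mulr_sumr.
Qed.

Lemma sum_abel_le n (s : nat -> C) (h1 h2 : 'I_n -> 'I_n -> C) :
  s n = 0 -> (forall i, (i < n)%N -> s i.+1 <= s i) ->
  (forall a b, (a <= n)%N -> (b <= n)%N -> block h1 a b <= block h2 a b) ->
  \sum_(j < n) \sum_(k < n) s j * s k * h1 j k <= \sum_(j < n) \sum_(k < n) s j * s k * h2 j k.
Proof.
move=> sn0 s_dec h12; rewrite !sum_abel //.
apply: ler_sum => a _; apply: ler_sum => b _.
by rewrite ler_wpM2l ?h12 // mulr_ge0 // subr_ge0 s_dec.
Qed.

(** * The minimizing signed permutation *)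

(** Swaps [2i] and [2i+1]; for odd [n] the last index has no mate and stays fixed. *)
Definition partner (n j : nat) : nat :=
  if odd j then j.-1 else if j.+1 == n then j else j.+1.

Lemma partner_lt n j : (j < n)%N -> (partner n j < n)%N.
Proof. by rewrite /partner; case: ifP; [lia|case: eqP; lia]. Qed.

Lemma partnerK n j : (j < n)%N -> partner n (partner n j) = j.
Proof.
rewrite /partner => lt_jn; case: (boolP (odd j)) => oj.
  rewrite (_ : odd j.-1 = false); last lia.
  by case: eqP; lia.
case: (j.+1 =P n) => [e|ne]; first by rewrite (negPf oj) e eqxx.
by rewrite /= oj.
Qed.

Lemma odd_partner n j : partner n j != j -> odd (partner n j) = ~~ odd j.
Proof.
rewrite /partner; case: (boolP (odd j)) => oj.
  by case: j oj => // j /= /negPf.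
by case: ifP => _ //=; rewrite eqxx.
Qed.

Definition partner_ord n (j : 'I_n) : 'I_n := Ordinal (partner_lt (ltn_ord j)).

Lemma partner_ordK n : involutive (@partner_ord n).
Proof. by move=> j; apply: val_inj; rewrite /= partnerK. Qed.

(** Block diagonal with blocks [((0, 1), (-1, 0))], and a final [1] for odd [n]; the opposite signs
    make each pair contribute negatively. *)
Definition pairing_mx n : 'M[C]_n :=
  \matrix_(j, k) ((-1) ^+ odd j * (k == partner_ord j)%:R).

Lemma pairing_mx_unitary n : unitary (pairing_mx n).
Proof.
apply/matrixP=> i k; rewrite !mxE (bigD1 (partner_ord i)) //= big1 ?addr0; last first.
  by move=> l /negPf nl; rewrite !mxE nl mulr0 mul0r.
rewrite !mxE eqxx mulr1 (inj_eq (inv_inj (@partner_ordK n))) rmorphM rmorph_nat.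
rewrite rmorphXn rmorphN1; case: eqVneq => [->|_]; last by rewrite !mulr0.
by rewrite mulr1 -expr2 sqrr_sign.
Qed.

Lemma flip_form_pairing n (j k : 'I_n) :
  flip_form (pairing_mx n) j k =
  if k == partner_ord j then (if partner n j == j then 2 else - 2) else 0.
Proof.
rewrite /flip_form !mxE !rmorphM !rmorph_nat !rmorphXn !rmorphN1.
rewrite [j == _]eq_sym (canF_eq (@partner_ordK n)).
case: (eqVneq k _) => [->|_]; last by rewrite !(mulr0, mul0r) addr0.
rewrite !mulr1 /=; case: eqVneq => [->|ne].
  by rewrite -expr2 sqrr_sign.
by rewrite odd_partner //; case: (odd j); rewrite !expr1 !expr0; ring.
Qed.

Lemma block_pairing n a b : (a <= n)%N ->
  block (flip_form (pairing_mx n)) a b =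
  \sum_(j < a) (if (partner n j < b)%N
                then (if partner n j == j then 2 else - 2) else 0).
Proof.
move=> le_an; rewrite /block.
rewrite [RHS](big_ord_widen _ (fun j => if (partner n j < b)%N
                then (if partner n j == j then 2 else - 2) else 0) le_an).
apply: eq_bigr => j _; rewrite big_mkcond (bigD1 (partner_ord j)) //= big1 ?addr0.
  by rewrite flip_form_pairing eqxx.
by move=> k /negPf nk; rewrite flip_form_pairing nk; case: ifP.
Qed.

Lemma block_pairing_const n a b : (a <= n)%N ->
  (forall j, (j < a)%N -> (partner n j < b)%N && (partner n j != j)) ->
  block (flip_form (pairing_mx n)) a b = - (2 * a%:R).
Proof.
move=> le_an h; rewrite block_pairing // (eq_bigr (fun=> - 2)) => [|j _].
  by rewrite sumr_const card_ord mulr_natr mulNrn.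
by have /andP[-> /negPf ->] := h _ (ltn_ord j).
Qed.

Lemma block_flip_formC n (Y : 'M[C]_n) a b :
  block (flip_form Y) a b = block (flip_form Y) b a.
Proof.
rewrite /block exchange_big; apply: eq_bigr => j _.
by apply: eq_bigr => k _; rewrite flip_formC.
Qed.

Lemma block_pairing_le n (U : 'M[C]_n) a b : unitary U ->
  (a <= n)%N -> (b <= n)%N ->
  block (flip_form (pairing_mx n)) a b <= block (flip_form U) a b.
Proof.
move=> hU; wlog le_ab : a b / (a <= b)%N => [hwlog|] le_an le_bn.
  case: (leqP a b) => [|/ltnW] le_ab; first exact: hwlog.
  by rewrite block_flip_formC [leRHS]block_flip_formC hwlog.
(* For [j < a < b] the partner is at most [a], and [j] is not the last index, so no row is fixed and
   every row gives [-2]. *)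
have [lt_ab|ge_ab] := ltnP a b.
  rewrite block_pairing_const ?flip_block_ge // => j lt_ja.
  by rewrite /partner; case: ifP; [lia|case: eqP; lia].
have -> : b = a by lia.
case: (boolP (odd a)) => [a_odd|a_even]; last first.
  rewrite block_pairing_const ?flip_block_ge // => j lt_ja.
  by rewrite /partner; case: ifP; [lia|case: eqP; lia].
(* The last row [a.-1] is even: its partner [a] lies outside the block, unless [a = n] makes it a
   fixed point contributing [2]. *)
have pE : block (flip_form (pairing_mx n)) a a =
    - (2 * (a.-1)%:R) + (if a == n then 2 else 0).
  rewrite block_pairing //; case: a {le_ab ge_ab} a_odd le_an => // m m_even lt_mn.
  rewrite big_ord_recr /=; congr (_ + _); last first.
    have om : odd m = false by apply/negbTE.
    by rewrite /partner om; case: eqP => _; rewrite ?ltnn ?ltnSn ?eqxx.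
  rewrite (eq_bigr (fun=> - 2)) => [|j _].
    by rewrite sumr_const card_ord mulr_natr mulNrn.
  have lt_jm := ltn_ord j.
  have /andP[-> /negPf ->] // : (partner n j < m.+1)%N && (partner n j != j).
  by rewrite /partner; case: ifP; [lia|case: eqP; lia].
rewrite pE; case: eqP => [an|_]; last by rewrite addr0 flip_block_odd_ge.
rewrite an in a_odd *; apply: le_trans (_ : _ <= \sum_j \sum_k flip_form U j k) _.
  apply: le_trans (flip_full_odd_ge hU a_odd).
  rewrite -{2}(prednK (odd_gt0 a_odd)) -natr1 le_eqVlt; apply/orP; left.
  by apply/eqP; ring.
rewrite le_eqVlt /block; apply/orP; left; apply/eqP.
apply: eq_big => [j|j _]; first by rewrite ltn_ord.
by apply: eq_bigl => k; rewrite ltn_ord.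
Qed.

(** This is [threshold] without its factor [d^-1], for a sequence indexed by [nat]. *)
Definition paired_sum (n : nat) (s : nat -> C) : C :=
  2 * (\sum_(i < n./2) s i.*2 * s i.*2.+1) - (if odd n then s n.-1 ^+ 2 else 0).

Lemma sum_double m (F : nat -> C) :
  \sum_(j < m.*2) F j = \sum_(i < m) (F i.*2 + F i.*2.+1).
Proof.
elim: m => [|m IHm]; first by rewrite !big_ord0.
by rewrite doubleS !big_ord_recr /= IHm addrA.
Qed.

(** Rows [2i] and [2i+1] together give [-4 s_2i s_(2i+1)]; the fixed index of an odd [n] gives
    [2 s_(n-1)^2]. *)
Lemma sum_pairing n (s : nat -> C) :
  \sum_(j < n) \sum_(k < n) s j * s k * flip_form (pairing_mx n) j k = - (2 * paired_sum n s).
Proof.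
pose F j := s j * s (partner n j) * (if partner n j == j then 2 else - 2).
transitivity (\sum_(j < n) F j).
  apply: eq_bigr => j _; rewrite (bigD1 (partner_ord j)) //= big1 ?addr0.
    by rewrite flip_form_pairing eqxx.
  by move=> k /negPf nk; rewrite flip_form_pairing nk mulr0.
have F2 i : (i.*2.+1 < n)%N -> F i.*2 + F i.*2.+1 = - (4 * (s i.*2 * s i.*2.+1)).
  move=> lt_in; rewrite /F /partner /= odd_double /=.
  rewrite (ltn_eqF lt_in) (gtn_eqF (ltnSn _)) (ltn_eqF (ltnSn _)); ring.
have FS m : m = n./2 -> \sum_(j < m.*2) F j = - (4 * \sum_(i < m) s i.*2 * s i.*2.+1).
  move=> mE; rewrite sum_double mulr_sumr -sumrN; apply: eq_bigr => i _.
  by apply: F2; have := ltn_ord i; lia.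
rewrite /paired_sum -(big_mkord xpredT F); have nE := odd_double_half n.
case: (boolP (odd n)) nE => n_odd nE.
  rewrite -{1}nE big_mkord big_ord_recr /= (FS _ erefl) /F.
  have -> : n./2.*2 = n.-1 by lia.
  rewrite /partner (_ : odd n.-1 = false); last by lia.
  by rewrite prednK ?odd_gt0 // !eqxx; ring.
by rewrite -{1}nE big_mkord (FS _ erefl); ring.
Qed.

(** * Traces against Choi states *)

Lemma sum_mxtens m n (F : 'I_(m * n) -> C) :
  \sum_a F a = \sum_j \sum_k F (mxtens_index (j, k)).
Proof.
rewrite pair_big (reindex (@mxtens_index m n)) /=.
  by apply: eq_bigr => -[].
by exists (@mxtens_unindex m n) => i _; rewrite (mxtens_indexK, mxtens_unindexK).
Qed.

(** Vectorization: [1 *t A] maps [|j,j>] to [|j>] tensor column [j] of [A], hence the transposed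
    indices. *)
Lemma tens_omegaE d (A : 'M[C]_d) j k a :
  (((1%:M : 'M[C]_d) *t A) *m omega C d) (mxtens_index (j, k)) a =
  (sqrtC d%:R)^-1 * A k j.
Proof.
have tensE (l : 'I_d) : ((1%:M : 'M[C]_d) *t A) *m
    ((delta_mx l 0 : 'cV[C]_d) *t (delta_mx l 0 : 'cV[C]_d) : 'cV_(d * d)) =
    (delta_mx l 0 : 'cV[C]_d) *t (A *m (delta_mx l 0 : 'cV[C]_d)).
  by rewrite -[X in X *t (A *m _)]mul1mx;
    exact (tensmx_mul 1%:M A (delta_mx l 0 : 'cV_d) (delta_mx l 0 : 'cV_d)).
rewrite /omega -scalemxAr mulmx_sumr mxE summxE; congr (_ * _).
rewrite (bigD1 j) //= big1 ?addr0 => [|l /negPf nl]; rewrite tensE !mxE mxtens_indexK /=.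
  rewrite !ord1 !eqxx mul1r (bigD1 j) //= big1 ?addr0 => [|i /negPf ni]; rewrite !mxE.
    by rewrite !eqxx mulr1.
  by rewrite ni mulr0.
by rewrite eq_sym nl mul0r.
Qed.

Lemma omega_scalar d : ((sqrtC d%:R)^-1)^* * (sqrtC d%:R)^-1 = d%:R^-1 :> C.
Proof.
have /ger0_real/CrealP -> : 0 <= (sqrtC d%:R)^-1 :> C.
  by rewrite invr_ge0 sqrtC_ge0 ler0n.
by rewrite -expr2 exprVn sqrtCK.
Qed.

Lemma adjmx_tens1 d (A : 'M[C]_d) :
  adjmx ((1%:M : 'M[C]_d) *t A) = (1%:M : 'M[C]_d) *t adjmx A.
Proof. by rewrite /adjmx map_mxT trmx_tens map_mx1 trmx1. Qed.

Lemma trace_sandwich_choi d (M : 'M[C]_(d * d)) (U : 'M[C]_d) :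
  let psi := ((1%:M : 'M[C]_d) *t U) *m omega C d in
  \tr (M *m choi_unitary U) = \tr (adjmx psi *m M *m psi).
Proof.
rewrite /= /choi_unitary -adjmx_tens1 adjmxM.
by rewrite [RHS]mxtrace_mulC !mulmxA [RHS]mxtrace_mulC !mulmxA.
Qed.

Lemma trace_choi_unitary d (U : 'M[C]_d) :
  (1 <= d)%N -> unitary U -> \tr (choi_unitary U) = 1.
Proof.
move=> d_gt0 hU; rewrite -[choi_unitary U]mul1mx trace_sandwich_choi mulmx1.
rewrite -sqnorm_trace /sqnorm sum_mxtens.
transitivity (d%:R^-1 * sqnorm U).
  rewrite -sqnorm_tr mulr_sumr; apply: eq_bigr => j _.
  rewrite mulr_sumr; apply: eq_bigr => k _.
  rewrite big_ord_recl big_ord0 addr0 tens_omegaE normrM exprMn mxE; congr (_ * _).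
  by rewrite normCK mulrC omega_scalar.
by rewrite sqnorm_unitary // mulVf // pnatr_eq0 -lt0n.
Qed.

Lemma trace_flip_choi d (B U : 'M[C]_d) :
  let X := adjmx U *m B in
  \tr ((((1%:M : 'M[C]_d) *t B) *m flip C d *m ((1%:M : 'M[C]_d) *t adjmx B))
       *m choi_unitary U) =
  d%:R^-1 * \sum_j \sum_k X j k * (X k j)^*.
Proof.
move=> X; rewrite trace_sandwich_choi.
pose psi := ((1%:M : 'M[C]_d) *t adjmx X) *m omega C d.
set T := (X in \tr X); have -> : T = adjmx psi *m flip C d *m psi.
  have XE : (1%:M : 'M[C]_d) *t adjmx X =
      ((1%:M : 'M[C]_d) *t adjmx B) *m ((1%:M : 'M[C]_d) *t U).
    by rewrite tensmx_mul mul1mx /X adjmxM adjmxK.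
  by rewrite /T /psi XE !adjmxM !adjmx_tens1 adjmxK !mulmxA.
rewrite /psi; clear T psi; move: X => X.
rewrite trace_mx11 -mulmxA mxE sum_mxtens mulr_sumr.
apply: eq_bigr => j _; rewrite mulr_sumr; apply: eq_bigr => k _.
rewrite adjmxE tens_omegaE [(flip _ _ *m _) _ _]mxE (bigD1 (mxtens_index (k, j))) //= big1 ?addr0.
  rewrite tens_omegaE rmorphM /= !adjmxE conjCK mxE !mxtens_indexK /= !eqxx mul1r.
  by rewrite mulrACA omega_scalar.
move=> b; case: (mxtens_indexP b) => l m ne; rewrite mxE !mxtens_indexK /=.
rewrite (_ : _ && _ = false) ?mul0r //; apply: contraNF ne.
by case/andP=> /eqP -> /eqP ->.
Qed.

(** * Reduction to singular values *)

Lemma trace_mul_conj d (A : 'M[C]_d) :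
  \tr (A *m map_mx Num.conj A) = \sum_j \sum_k A j k * (A k j)^*.
Proof.
by apply: eq_bigr => j _; rewrite mxE; apply: eq_bigr => k _; rewrite mxE.
Qed.

(** As [S] is real, cyclicity turns [tr(Z S V conj(Z S V))] into [tr(Y S conj(Y) S)]. *)
Lemma trace_conj_svd d (Z V : 'M[C]_d) (s : 'I_d -> C) :
  (forall i, 0 <= s i) ->
  let X := Z *m diag_mx (\row_i s i) *m V in
  let Y := map_mx Num.conj V *m Z in
  2 * (\sum_j \sum_k X j k * (X k j)^*) =
  \sum_j \sum_k s j * s k * flip_form Y j k.
Proof.
move=> s_ge0 X Y; pose S := diag_mx (\row_i s i).
have S_real : map_mx Num.conj S = S.
  apply/matrixP=> i j; rewrite !mxE rmorphMn /=.
  by rewrite (CrealP (ger0_real (s_ge0 i))).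
rewrite -trace_mul_conj.
have -> : \tr (X *m map_mx Num.conj X) = \tr (Y *m S *m (map_mx Num.conj Y *m S)).
  have VV : map_mx Num.conj (map_mx Num.conj V) = V.
    by apply/matrixP=> i j; rewrite !mxE conjCK.
  rewrite /X /Y !map_mxM VV S_real !mulmxA [LHS]mxtrace_mulC.
  by rewrite !mulmxA.
have -> : \tr (Y *m S *m (map_mx Num.conj Y *m S)) =
    \sum_j \sum_k s j * s k * (Y j k * (Y k j)^*).
  apply: eq_bigr => j _; rewrite mxE; apply: eq_bigr => k _.
  by rewrite !mul_mx_diag !mxE; ring.
(* Adding the copy with [j] and [k] exchanged produces [flip_form]. *)
rewrite mulr_natl mulr2n -{2}exchange_big -big_split; apply: eq_bigr => j _ /=.
rewrite -big_split; apply: eq_bigr => k _ /=.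
by rewrite /flip_form; ring.
Qed.

Lemma sv_nat_ord d (sv : 'I_d -> C) (i : 'I_d) : sv_nat sv i = sv i.
Proof. by rewrite /sv_nat valK. Qed.

(** The default value supplies the boundary condition of Abel summation. *)
Lemma sv_nat_dim d (sv : 'I_d -> C) : sv_nat sv d = 0.
Proof. by rewrite /sv_nat insubF // ltnn. Qed.

Lemma sv_nat_decreasing d (sv : 'I_d -> C) i :
  (forall k, 0 <= sv k) -> (forall j k : 'I_d, (j <= k)%N -> sv k <= sv j) ->
  (i < d)%N -> sv_nat sv i.+1 <= sv_nat sv i.
Proof.
move=> sv_ge0 sv_dec lt_id; rewrite /sv_nat (insubT (fun k => k < d)%N lt_id).
(* When [i.+1 = d] the left side is the default [0]. *)
case: insubP => [k _ ki|_]; last exact: sv_ge0.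
by apply: sv_dec; rewrite ki /=.
Qed.

Lemma sum_sv_pairing d (sv : 'I_d -> C) : (1 <= d)%N ->
  \sum_j \sum_k sv j * sv k * flip_form (pairing_mx d) j k =
  - (2 * d%:R * threshold sv).
Proof.
move=> d_gt0; have d0 : d%:R != 0 :> C by rewrite pnatr_eq0 -lt0n.
rewrite /threshold mulrA -[_ * d%:R^-1]mulrA mulfV // mulr1.
rewrite -[X in 2 * X]/(paired_sum d (sv_nat sv)) -sum_pairing.
by do 2!apply: eq_bigr => ? _; rewrite !sv_nat_ord.
Qed.

Lemma flip_form_sv_ge d (sv : 'I_d -> C) (Y : 'M[C]_d) :
  (1 <= d)%N ->
  (forall i, 0 <= sv i) -> (forall j k : 'I_d, (j <= k)%N -> sv k <= sv j) ->
  unitary Y ->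
  - (2 * d%:R * threshold sv) <= \sum_j \sum_k sv j * sv k * flip_form Y j k.
Proof.
move=> d_gt0 sv_ge0 sv_dec hY; rewrite -sum_sv_pairing //.
have h (Z : 'M[C]_d) : \sum_j \sum_k sv j * sv k * flip_form Z j k =
    \sum_(j < d) \sum_(k < d) sv_nat sv j * sv_nat sv k * flip_form Z j k.
  by do 2!apply: eq_bigr => ? _; rewrite !sv_nat_ord.
rewrite !h; apply: sum_abel_le (sv_nat_dim sv) _ _ => [i|a b].
  exact: sv_nat_decreasing.
exact: block_pairing_le.
Qed.

End FlipWitness.

Theorem theorem3 (C : numClosedFieldType) (d : nat) (B : 'M[C]_d) (sv : 'I_d -> C)
  (w : C) :
  (1 <= d)%N -> singular_values B sv -> w \is Num.real ->
  let W := ((1%:M : 'M[C]_d) *t B) *m flip C d *m ((1%:M : 'M[C]_d) *t adjmx B)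
           + w%:M in
  (forall s : 'M[C]_(d * d), in_U s -> 0 <= \tr (W *m s)) <->
  threshold sv <= w.
Proof.
move=> d_gt0 [sv_ge0 [sv_dec [P [Q [hP [hQ BE]]]]]] _ W.
have d2_gt0 : 0 < 2 * d%:R :> C by rewrite mulr_gt0 ?ltr0n.
have hQc : unitary (map_mx Num.conj Q).
  rewrite -[map_mx _ _]trmxK; apply: unitary_tr; exact: unitary_adj.
(* The factor [2 d] clears [d^-1] and makes room for the symmetrized form. *)
have trW U : unitary U -> 2 * d%:R * \tr (W *m choi_unitary U) =
    \sum_j \sum_k sv j * sv k * flip_form (map_mx Num.conj Q *m (adjmx U *m P)) j k
    + 2 * d%:R * w.
  move=> hU; rewrite mulmxDl mxtraceD mul_scalar_mx mxtraceZ trace_choi_unitary //.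
  rewrite mulr1 mulrDr; congr (_ + _).
  rewrite -trace_conj_svd // trace_flip_choi BE !mulmxA mulrA; congr (_ * _).
  by rewrite -mulrA mulfV ?mulr1 // pnatr_eq0 -lt0n.
split=> [hW|le_w s [k [p [U [p_ge0 [_ [hU ->]]]]]]].
  (* Solves [conj(Q) U^* P = pairing_mx] for [U], so the minimum is attained. *)
  pose U := P *m adjmx (pairing_mx C d) *m map_mx Num.conj Q.
  have hU : unitary U.
    apply: unitary_mul => //; apply: unitary_mul => //.
    exact/unitary_adj/pairing_mx_unitary.
  have /hW : in_U (choi_unitary U).
    exists 1%N, (fun=> 1), (fun=> U); split; first by [].
    by rewrite !big_ord1 scale1r.
  rewrite -(pmulr_rge0 _ d2_gt0) trW //.
  have -> : map_mx Num.conj Q *m (adjmx U *m P) = pairing_mx C d.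
    rewrite /U !adjmxM adjmxK -!mulmxA (mulmx1C hP) mulmx1 mulmxA.
    by rewrite hQc mul1mx.
  by rewrite sum_sv_pairing // addrC subr_ge0 ler_pM2l.
(* By linearity it suffices to treat each Choi state [choi_unitary (U i)]. *)
rewrite mulmx_sumr raddf_sum /=; apply: sumr_ge0 => i _.
rewrite -scalemxAr mxtraceZ mulr_ge0 //.
rewrite -(pmulr_rge0 _ d2_gt0) trW //.
apply: le_trans (lerD (flip_form_sv_ge _ _ _ _) (lexx _)) => //.
  by rewrite addrC subr_ge0 ler_pM2l.
apply: unitary_mul => //; apply: unitary_mul => //; exact: unitary_adj.
Qed.
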